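(* Assume that for every $\lambda\in\mathbb{R}^m$ the point $\bar z(\lambda)\in Z$ satisfies $$\min_{z\in Z}\langle \nabla\mathcal{L}_\rho(\bar z(\lambda),\lambda),\, z-\bar z(\lambda)\rangle \ge -\left(1+\sqrt{2L_{\mathrm p}}\,R_{\mathrm p}\right)\varepsilon_{\mathrm{in}} .$$ Let $\theta_0=1$, $\theta_{k+1}=\frac12\left(1+\sqrt{4\theta_k^2+1}\right)$, $S_k=\sum_{j=0}^k\theta_j$, $a_{k+1}=S_{k+1}^{-1}\theta_{k+1}$, and let $(\lambda_k)_{k\ge0}$, $(\mu_k)_{k\ge0}$ be generated from $\lambda_0\in\mathbb{R}^m$ by $$\mu_k=\lambda_k+L_{\mathrm d}^{-1}\nabla\bar d_\rho(\lambda_k),\qquad \lambda_{k+1}=(1-a_{k+1})\mu_k+a_{k+1}\Big[\lambda_0+L_{\mathrm d}^{-1}\sum_{i=0}^k\theta_i\nabla\bar d_\rho(\lambda_i)\Big].$$ Let $\bar z_j=\bar z(\lambda_j)$ and $\hat z_k=S_k^{-1}\sum_{j=0}^k\theta_j\bar z_j$. Then for every $k\ge0$ $$\|A\hat z_k-b\|\le v(k,\varepsilon_{\mathrm{in}}),\qquad v(k,\varepsilon_{\mathrm{in}}):=\frac{8L_{\mathrm d}R_{\mathrm d}}{(k+1)(k+2)}+4\sqrt{\frac{2L_{\mathrm d}(k+3)\left(1+\sqrt{2L_{\mathrm p}}\,R_{\mathrm p}\right)\varepsilon_{\mathrm{in}}}{3(k+1)(k+2)}},$$ where $R_{\mathrm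 d}=\|\lambda_0-\lambda^*\|$.
   Context: Setting: $f:\mathbb{R}^n\to\mathbb{R}$ is convex and differentiable, $A\in\mathbb{R}^{m\times n}$ has full row rank, $b\in\mathbb{R}^m$, $Z\subset\mathbb{R}^n$ is nonempty, compact and convex, $\rho>0$, $\varepsilon_{\mathrm{in}}>0$; $\|\cdot\|$ and $\langle\cdot,\cdot\rangle$ are the Euclidean norm and inner product. Primal problem: $f^*=\min\{f(z): Az=b,\ z\in Z\}$. Augmented Lagrangian: $\mathcal{L}_\rho(z,\lambda)=f(z)+\langle\lambda,Az-b\rangle+\frac\rho2\|Az-b\|^2$; $\nabla\mathcal{L}_\rho$ denotes its gradient in $z$, assumed Lipschitz continuous in $z$ on $\mathbb{R}^n$ with constant $L_{\mathrm p}>0$ for each $\lambda$. $R_{\mathrm p}=\max_{z,y\in Z}\|z-y\|$. Augmented dual function: $d_\rho(\lambda)=\min_{z\in Z}\mathcal{L}_\rho(z,\lambda)$. Slater's constraint qualification is assumed, so that $f^*=\max_{\lambda}\min_{z\in Z}\{f(z)+\langle\lambda,Az-b\rangle\}$; $\lambda^*$ denotes a maximizer of this dual problem (the ordinary dual and the problem $\max_\lambda d_\rho(\lambda)$ have the same optimal value and the same optimal solutions). $L_{\mathrm d}=1/\rho$. Inexact dual information: for each $\lambda$ an approximate minimizer $\bar z(\lambda)\in Z$ of $\mathcal{L}_\rho(\cdot,\lambda)$ over $Z$ is fixed, and $\nabla\bar d_\rho(\lambda):=A\bar z(\lambda)-b$ (a notation, not necessarily a gradient). *)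

(* Defs.v *)
From HB Require Import structures.
From mathcomp Require Import all_boot all_order all_algebra.
From mathcomp Require Import all_classical all_reals all_analysis.

Set Implicit Arguments.
Unset Strict Implicit.
Unset Printing Implicit Defensive.

Import Order.TTheory GRing.Theory Num.Theory.
Import numFieldNormedType.Exports.

Local Open Scope classical_set_scope.
Local Open Scope ring_scope.

Definition dotv (R : realType) (n : nat) (x y : 'cV[R]_n) : R :=
  \sum_(i < n) x i ord0 * y i ord0.

(* The library norm `|x| on matrices is the sup norm; the Euclidean norm induces
   the same topology, so that [compact] and [differentiable] are unaffected. *)
Definition enorm (R : realType) (n : nat) (x : 'cV[R]_n) : R :=
  Num.sqrt (dotv x x).

Definition grad (R : realType) (n : nat) (g : 'cV[R]_n -> R) (z : 'cV[R]_n) :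
    'cV[R]_n :=
  \col_(i < n) 'D_(delta_mx i ord0) g z.

(* [inf] and [sup] on reals are 0 on sets that are empty or unbounded; below, Z
   is compact and nonempty and g is continuous, so these extrema are attained. *)
Definition min_over (R : realType) (n : nat) (Z : set 'cV[R]_n)
    (g : 'cV[R]_n -> R) : R :=
  inf [set g z | z in Z].

Definition diameter (R : realType) (n : nat) (Z : set 'cV[R]_n) : R :=
  sup [set enorm (z - y) | z in Z & y in Z].

Definition affine_hull (R : realType) (n : nat) (Z : set 'cV[R]_n) :
    set 'cV[R]_n :=
  [set x | exists (k : nat) (c : 'I_k -> R) (p : 'I_k -> 'cV[R]_n),
     [/\ forall i, Z (p i), \sum_(i < k) c i = 1
       & x = \sum_(i < k) c i *: p i]].

Definition relint (R : realType) (n : nat) (Z : set 'cV[R]_n) : set 'cV[R]_n :=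
  [set z | Z z /\ exists2 e : R, 0 < e &
     forall x, affine_hull Z x -> enorm (x - z) < e -> Z x].

Definition slater (R : realType) (m n : nat) (A : 'M[R]_(m, n)) (b : 'cV[R]_m)
    (Z : set 'cV[R]_n) : Prop :=
  exists2 z, relint Z z & A *m z = b.

Definition lagr (R : realType) (m n : nat) (f : 'cV[R]_n -> R)
    (A : 'M[R]_(m, n)) (b : 'cV[R]_m) (l : 'cV[R]_m) (z : 'cV[R]_n) : R :=
  f z + dotv l (A *m z - b).

Definition aug_lagr (R : realType) (m n : nat) (f : 'cV[R]_n -> R)
    (A : 'M[R]_(m, n)) (b : 'cV[R]_m) (rho : R) (l : 'cV[R]_m) (z : 'cV[R]_n) :
    R :=
  f z + dotv l (A *m z - b) + rho / 2 * enorm (A *m z - b) ^+ 2.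

Definition dual (R : realType) (m n : nat) (f : 'cV[R]_n -> R)
    (A : 'M[R]_(m, n)) (b : 'cV[R]_m) (Z : set 'cV[R]_n) (l : 'cV[R]_m) : R :=
  min_over Z (lagr f A b l).

Definition dual_solution (R : realType) (m n : nat) (f : 'cV[R]_n -> R)
    (A : 'M[R]_(m, n)) (b : 'cV[R]_m) (Z : set 'cV[R]_n) (ls : 'cV[R]_m) :
    Prop :=
  forall l, dual f A b Z l <= dual f A b Z ls.

Fixpoint theta (R : realType) (k : nat) : R :=
  if k is k'.+1 then (1 + Num.sqrt (4 * theta R k' ^+ 2 + 1)) / 2 else 1.

Definition Ssum (R : realType) (k : nat) : R := \sum_(j < k.+1) theta R j.

Definition acoef (R : realType) (k : nat) : R := (Ssum R k)^-1 * theta R k.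

(* delta stands for (1 + sqrt (2 Lp) Rp) * eps_in *)
Definition feas_bound (R : realType) (Ld Rd delta : R) (k : nat) : R :=
  8 * Ld * Rd / ((k%:R + 1) * (k%:R + 2)) +
  4 * Num.sqrt (2 * Ld * (k%:R + 3) * delta / (3 * (k%:R + 1) * (k%:R + 2))).

(* Main.v *)
(** Writing [w(z) = A z - b], convexity of [f] turns the approximate optimality
    condition at [z(l)] into a [(delta, 1/rho)]-inexact oracle for the augmented
    dual function [D]: for every [mu],
    [0 <= L_rho(z(l), mu) - D(mu) <= |mu - l|^2 / (2 rho) + delta],
    where completing a square in [w] makes the constant exactly [1/rho].
    The estimate-sequence argument for the fast gradient method then bounds, for
    every multiplier [l],
    [sum_j theta_j L_rho(z_j, l) - Ld/2 |l - l0|^2] by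
    [S_k D(mu_k) + delta sum_j S_j].  Since [D <= d(l_star)] and
    [L_rho(z_j, l) >= d(l_star) + <l - l_star, w(z_j)>], taking
    [l = l0 + G / Ld] with [G = sum_j theta_j w(z_j) = S_k (A zhat_k - b)] gives
    [|G|^2 / (2 Ld) <= |l0 - l_star| |G| + delta sum_j S_j], and the bound follows
    from [(k+1)(k+2)/4 <= S_k <= (k+1)(k+2)/2]. *)

Require Import Defs.
From HB Require Import structures.
From mathcomp Require Import all_boot all_order all_algebra.
From mathcomp Require Import all_classical all_reals all_analysis.
From mathcomp Require Import ring lra.

Set Implicit Arguments.
Unset Strict Implicit.
Unset Printing Implicit Defensive.

Import Order.TTheory GRing.Theory Num.Theory.
Import numFieldNormedType.Exports.

Local Open Scope classical_set_scope.
Local Open Scope ring_scope.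

(** * Euclidean inner product, norm and gradient on column vectors *)

Section EuclideanSpace.
Variables (R : realType) (n : nat).
Implicit Types (x y z : 'cV[R]_n) (a : R).

Lemma dotvC x y : dotv x y = dotv y x.
Proof. by apply: eq_bigr => i _; rewrite mulrC. Qed.

Lemma dotvDl x y z : dotv (x + y) z = dotv x z + dotv y z.
Proof. by rewrite -big_split; apply: eq_bigr => i _; rewrite mxE mulrDl. Qed.

Lemma dotvZl a x y : dotv (a *: x) y = a * dotv x y.
Proof. by rewrite big_distrr; apply: eq_bigr => i _; rewrite mxE -mulrA. Qed.

Lemma dotvNl x y : dotv (- x) y = - dotv x y.
Proof. by rewrite -scaleN1r dotvZl mulN1r. Qed.

Lemma dotvDr x y z : dotv x (y + z) = dotv x y + dotv x z.
Proof. by rewrite dotvC dotvDl !(dotvC x). Qed.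

Lemma dotvZr a x y : dotv x (a *: y) = a * dotv x y.
Proof. by rewrite dotvC dotvZl (dotvC x). Qed.

Lemma dotvNr x y : dotv x (- y) = - dotv x y.
Proof. by rewrite dotvC dotvNl (dotvC x). Qed.

Definition dotv_linear := (dotvDl, dotvDr, dotvNl, dotvNr, dotvZl, dotvZr).

Lemma dotv0r x : dotv x 0 = 0.
Proof. by rewrite -(scale0r 0) dotvZr mul0r. Qed.

Lemma dotv_sumr (I : Type) (r : seq I) (P : pred I) (F : I -> 'cV[R]_n) x :
  dotv x (\sum_(i <- r | P i) F i) = \sum_(i <- r | P i) dotv x (F i).
Proof. exact: (big_morph _ (dotvDr x) (dotv0r x)). Qed.

Lemma dotv_ge0 x : 0 <= dotv x x.
Proof. by apply: sumr_ge0 => i _; rewrite -expr2 sqr_ge0. Qed.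

Lemma enorm_ge0 x : 0 <= enorm x.
Proof. exact: sqrtr_ge0. Qed.

Lemma sqr_enorm x : enorm x ^+ 2 = dotv x x.
Proof. by rewrite sqr_sqrtr ?dotv_ge0. Qed.

Lemma enormZ a x : 0 <= a -> enorm (a *: x) = a * enorm x.
Proof.
move=> a0; rewrite /enorm dotvZl dotvZr mulrA -expr2 sqrtrM ?sqr_ge0//.
by rewrite sqrtr_sqr ger0_norm.
Qed.

Lemma dotv_eq0 x : dotv x x = 0 -> x = 0.
Proof.
move=> /eqP; rewrite psumr_eq0 => [/allP x0|i _]; last by rewrite -expr2 sqr_ge0.
apply/matrixP => i j; rewrite (ord1 j) mxE; apply/eqP.
by have := x0 i (mem_index_enum i); rewrite mulf_eq0 orbb.
Qed.

Lemma cauchy_schwarz_dotv x y : - dotv x y <= enorm x * enorm y.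
Proof.
have [y0|yn0] := eqVneq (dotv y y) 0.
  by rewrite (dotv_eq0 y0) dotv0r oppr0 mulr_ge0 ?enorm_ge0.
have yy : 0 < dotv y y by rewrite lt0r yn0 dotv_ge0.
have H : dotv x y ^+ 2 <= (enorm x * enorm y) ^+ 2.
  rewrite exprMn !sqr_enorm.
  (* Up to the factor [dotv y y], this vector is the component of [x] orthogonal to [y]. *)
  have := dotv_ge0 (dotv y y *: x - dotv x y *: y).
  rewrite !dotv_linear (dotvC y x) => {}H.
  rewrite -(ler_pM2l yy); lra.
move: H; rewrite -real_normK ?num_real// ler_sqr ?nnegrE ?mulr_ge0 ?enorm_ge0//.
by apply: le_trans; rewrite -normrN ler_norm.
Qed.

Lemma differentiable_dotvr x z : differentiable (fun y => dotv x y) z.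
Proof.
rewrite (_ : (fun y => dotv x y) =
    \sum_(i < n) (fun y : 'cV[R]_n => x i ord0 * y i ord0)); last first.
  by apply/funext => y; rewrite fct_sumE.
apply: differentiable_sum => i.
apply: differentiableM; first exact: differentiable_cst.
exact: differentiable_coord.
Qed.

(** [grad] only collects partial derivatives; linearity of the differential recovers every
    directional derivative from them. *)
Lemma dotv_grad (g : 'cV[R]_n -> R) z x :
  differentiable g z -> dotv (grad g z) x = 'D_x g z.
Proof.
move=> dg; rewrite deriveE// {2}(matrix_sum_delta x) linear_sum.
apply: eq_bigr => i _; rewrite big_ord1 linearZ mxE deriveE//= mulrC.
by congr (_ * _).
Qed.

End EuclideanSpace.

(** * Convexity along segments and minima over compact sets *)

Section ConvexityAndMinima.
Variables (R : realType) (n : nat).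
Implicit Types (g : 'cV[R]_n -> R) (Z : set 'cV[R]_n) (x y z : 'cV[R]_n).

Lemma conv_segment x y (t : R) (t0 : 0 <= t) (t1 : t <= 1) :
  conv (Itv01 t0 t1) (y : convex_lmodType 'cV[R]_n) x = x + t *: (y - x).
Proof.
transitivity (t *: y + (1 - t) *: x); first by [].
by rewrite scalerBl scale1r scalerBr addrCA.
Qed.

Lemma convex_function_segment g x y (t : R) :
  convex_function [set: 'cV[R]_n] g -> 0 <= t -> t <= 1 ->
  g (x + t *: (y - x)) <= g x + t * (g y - g x).
Proof.
move=> gconv t0 t1.
have := gconv (Itv01 t0 t1) y x (in_setT _) (in_setT _).
rewrite conv_segment => /le_trans; apply.
apply: (@le_trans _ _ (t * g y + (1 - t) * g x)); first exact: lexx.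
by lra.
Qed.

Lemma convex_set_segment Z x y (t : R) :
  convex_set Z -> Z x -> Z y -> 0 <= t -> t <= 1 -> Z (x + t *: (y - x)).
Proof.
move=> Zconv Zx Zy t0 t1.
have := Zconv y x (Itv01 t0 t1) (mem_set Zy) (mem_set Zx).
by rewrite conv_segment => /set_mem.
Qed.

Lemma compact_argmin Z g : Z !=set0 -> compact Z ->
  (forall z, differentiable g z) -> exists2 z, Z z & forall y, Z y -> g z <= g y.
Proof.
move=> Z0 Zc dg.
have cg : {within Z, continuous g}.
  by apply: continuous_subspaceT => z; exact: differentiable_continuous.
have [z /set_mem Zz zmin] := compact_EVT_min Z0 Zc cg.
by exists z => // y /mem_set /zmin.
Qed.

Lemma le_min_over Z g (c : R) : Z !=set0 -> (forall z, Z z -> c <= g z) ->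
  c <= min_over Z g.
Proof.
move=> [z Zz] cg; apply: lb_le_inf; first by exists (g z), z.
by move=> _ [y Zy <-]; exact: cg.
Qed.

(** The bound [c] rules out the default value of [inf]. *)
Lemma min_over_lb Z g (c : R) z : (forall y, Z y -> c <= g y) -> Z z ->
  min_over Z g <= g z.
Proof.
move=> cg Zz; apply: ge_inf; last by exists z.
by exists c => _ [y Zy <-]; exact: cg.
Qed.

Lemma min_over_le Z g z : compact Z -> (forall y, differentiable g y) ->
  Z z -> min_over Z g <= g z.
Proof.
move=> Zc dg Zz; have Z0 : Z !=set0 by exists z.
have [y _ ymin] := compact_argmin Z0 Zc dg.
exact: min_over_lb ymin Zz.
Qed.

End ConvexityAndMinima.

(** * Growth of the weights and of their partial sums *)

Section ThetaSequence.
Variable R : realType.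

Lemma theta_gt0 k : 0 < theta R k.
Proof.
case: k => [|k] /=; first exact: ltr01.
by rewrite divr_gt0// ltr_wpDr// sqrtr_ge0.
Qed.

(** The recursion picks the positive root of [t^2 - t = theta_k^2]. *)
Lemma sqr_thetaS k : theta R k.+1 ^+ 2 = theta R k ^+ 2 + theta R k.+1.
Proof.
rewrite /=; set s := Num.sqrt _.
have : s ^+ 2 = 4 * theta R k ^+ 2 + 1.
  by rewrite sqr_sqrtr// addr_ge0// mulr_ge0// sqr_ge0.
by move=> sE; lra.
Qed.

Lemma SsumS k : Ssum R k.+1 = Ssum R k + theta R k.+1.
Proof. by rewrite /Ssum big_ord_recr. Qed.

Lemma Ssum_sqr_theta k : Ssum R k = theta R k ^+ 2.
Proof.
elim: k => [|k IH]; first by rewrite /Ssum big_ord1 /= expr1n.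
by rewrite SsumS IH sqr_thetaS.
Qed.

Lemma Ssum_gt0 k : 0 < Ssum R k.
Proof. by rewrite Ssum_sqr_theta exprn_gt0// theta_gt0. Qed.

Lemma theta_ge k : (k%:R + 2) / 2 <= theta R k.
Proof.
elim: k => [|k IH]; first by rewrite /= add0r divff.
have t0 := theta_gt0 k; have t1 := theta_gt0 k.+1.
suff: theta R k + 1 / 2 <= theta R k.+1 by rewrite -(natr1 k); lra.
have := sqr_thetaS k; move: (theta R k) (theta R k.+1) t0 t1 => s t s0 t0 H.
rewrite leNgt; apply/negP => ts.
(* The product is [s^2 - (t - 1/2)^2], which the recurrence makes equal to [-1/4]. *)
have : 0 < (s - (t - 1 / 2)) * (s + (t - 1 / 2)) by rewrite mulr_gt0//; nra.
by nra.
Qed.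

Lemma theta_le k : theta R k <= k%:R + 1.
Proof.
elim: k => [|k IH]; first by rewrite /= add0r.
have t0 := theta_gt0 k; have t1 := theta_gt0 k.+1.
suff: theta R k.+1 <= theta R k + 1 by rewrite -(natr1 k); lra.
have := sqr_thetaS k; move: (theta R k) (theta R k.+1) t0 t1 => s t s0 t0 H.
(* If [t > s + 1], then [t^2 - t = t (t - 1) > s^2], against the recurrence. *)
by rewrite leNgt; apply/negP => ts; nra.
Qed.

Lemma Ssum_ge k : (k%:R + 1) * (k%:R + 2) / 4 <= Ssum R k.
Proof.
rewrite Ssum_sqr_theta; have := theta_ge k; have : 0 <= k%:R :> R by [].
by move=> ? ?; nra.
Qed.

Lemma Ssum_le k : Ssum R k <= (k%:R + 1) * (k%:R + 2) / 2.
Proof.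
elim: k => [|k IH]; first by rewrite /Ssum big_ord1 /=; lra.
by rewrite SsumS; have := theta_le k.+1; rewrite -(natr1 k) => ?; lra.
Qed.

(** The bounds of [Ssum_le] are triangular numbers, whose sums are tetrahedral numbers. *)
Lemma sum_Ssum_le k :
  \sum_(j < k.+1) Ssum R j <= (k%:R + 1) * (k%:R + 2) * (k%:R + 3) / 6.
Proof.
elim: k => [|k IH]; first by rewrite big_ord1; have := Ssum_le 0; lra.
rewrite big_ord_recr /=; have := Ssum_le k.+1; rewrite -(natr1 k) => ?.
by lra.
Qed.

End ThetaSequence.

Arguments theta R k : simpl never.

(** * Fast gradient ascent with an inexact first-order oracle *)

Section FastGradient.
Variables (R : realType) (m : nat) (L delta : R) (D : 'cV[R]_m -> R).
Variables (ell : nat -> 'cV[R]_m -> R) (lambda mu g : nat -> 'cV[R]_m).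
Hypothesis L_gt0 : 0 < L.
Hypothesis ell_affine : forall k l l',
  ell k l' = ell k l + dotv (g k) (l' - l).
Hypothesis D_le_ell : forall k l, D l <= ell k l.
Hypothesis ell_le_D : forall k l,
  ell k l - L / 2 * dotv (l - lambda k) (l - lambda k) - delta <= D l.
Hypothesis muE : forall k, mu k = lambda k + L^-1 *: g k.

(** The maximiser in [l] of [sum_j theta_j ell_j(l) - L/2 |l - lambda_0|^2]. *)
Let nu k := lambda 0%N + L^-1 *: \sum_(i < k.+1) theta R i *: g i.

Hypothesis lambdaE : forall k, lambda k.+1 =
  (1 - acoef R k.+1) *: mu k + acoef R k.+1 *: nu k.

Let nuS k : nu k.+1 = nu k + (theta R k.+1 / L) *: g k.+1.
Proof.
by rewrite /nu (big_ord_recr k.+1) /= scalerDr addrA scalerA mulrC.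
Qed.

(** The step [L^-1 *: g k] maximises the concave quadratic lower model in [ell_le_D]. *)
Let gradient_step k : ell k (lambda k) + dotv (g k) (g k) / (2 * L) <= D (mu k) + delta.
Proof.
have Ln0 : L != 0 by rewrite gt_eqF.
have := ell_le_D k (mu k); rewrite (ell_affine k (lambda k)) muE (addrC (lambda k)) addrK.
rewrite !dotv_linear -lerBlDr; apply: le_trans.
by rewrite le_eqVlt; apply/orP; left; apply/eqP; field.
Qed.

(** The regularised sum of models is a quadratic in [l] peaking at [nu k], so adding the square in
    [l - nu k] yields its maximum whatever [l] is. Keeping [l] free lets the induction move the
    centre from [nu k] to [nu k.+1]. *)
Lemma estimate_sequence k l :
  \sum_(j < k.+1) theta R j * ell j l
    - L / 2 * dotv (l - lambda 0%N) (l - lambda 0%N)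
    + L / 2 * dotv (l - nu k) (l - nu k)
  <= Ssum R k * D (mu k) + delta * \sum_(j < k.+1) Ssum R j.
Proof.
have Ln0 : L != 0 by rewrite gt_eqF.
elim: k => [|k IH].
  have := gradient_step 0; rewrite /nu /Ssum !big_ord1 /= (_ : theta R 0 = 1)// !mul1r scale1r.
  rewrite (ell_affine 0 (lambda 0%N) l) !mulr1 opprD addrA.
  move: (l - lambda 0%N) => u; rewrite !dotv_linear (dotvC u (g 0%N)).
  apply: le_trans; by rewrite le_eqVlt; apply/orP; left; apply/eqP; field.
have S0 := Ssum_gt0 R k; have S1 := Ssum_gt0 R k.+1.
(* The extrapolated point divides the segment from [mu k] to [nu k] in the ratio
   [theta_(k+1) : S_k]. *)
have lam : Ssum R k *: (mu k - lambda k.+1) = theta R k.+1 *: (lambda k.+1 - nu k).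
  rewrite lambdaE /acoef SsumS; move: (nu k) => w; apply/matrixP => i j.
  by rewrite !mxE; field; rewrite -SsumS gt_eqF.
have step := gradient_step k.+1.
(* The new model bounds the old value [D (mu k)], and [lam] turns its slope term into one centred at
   [nu k]. *)
have DM : Ssum R k * D (mu k) <= Ssum R k * ell k.+1 (lambda k.+1)
    + theta R k.+1 * dotv (g k.+1) (lambda k.+1 - nu k).
  by rewrite -dotvZr -lam dotvZr -mulrDr -ell_affine ler_pM2l.
rewrite big_ord_recr /= [in X in _ <= X]big_ord_recr /= nuS.
rewrite (ell_affine k.+1 (lambda k.+1) l) opprD addrA.
move: IH DM; rewrite (_ : l - lambda k.+1 = (l - nu k) - (lambda k.+1 - nu k)); last first.
  by rewrite opprB addrA subrK.
move: (l - nu k) (lambda k.+1 - nu k) (l - lambda 0%N) => u v w IH DM.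
rewrite !dotv_linear (dotvC u (g _)).
have SE := Ssum_sqr_theta R k.+1.
have SS := SsumS R k.
have {}step := ler_wpM2l (ltW S1) step.
set gg := dotv (g k.+1) (g k.+1) in step *; set gu := dotv (g k.+1) u.
set t := theta R k.+1 in DM SE SS *.
(* Since [S_(k+1) = theta_(k+1)^2], moving the centre costs exactly the gain that [gradient_step]
   provides. *)
have -> : L / 2 * (dotv u u - t / L * gu + (- (t / L * gu) - t / L * - (t / L * gg)))
    = L / 2 * dotv u u - t * gu + Ssum R k.+1 * (gg / (2 * L)).
  by rewrite SE; field.
move: (gg / (2 * L)) step => q; rewrite SS => step.
by lra.
Qed.

Lemma fast_gradient_residual (Dstar : R) (ls : 'cV[R]_m) k
    (G := \sum_(j < k.+1) theta R j *: g j) :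
  (forall l, D l <= Dstar) ->
  (forall j l, Dstar + dotv (l - ls) (g j) <= ell j l) ->
  0 <= delta ->
  enorm G <= 2 * L * enorm (lambda 0%N - ls)
             + Num.sqrt (2 * L * (delta * \sum_(j < k.+1) Ssum R j)).
Proof.
move=> D_le le_ell delta0; set E := delta * _.
have Ln0 : L != 0 by rewrite gt_eqF.
have E0 : 0 <= E.
  by rewrite mulr_ge0// sumr_ge0// => j _; exact/ltW/Ssum_gt0.
have key : dotv (lambda 0%N - ls) G + dotv G G / (2 * L) <= E.
  (* At [l = nu k] one square vanishes and the regularisation becomes [|G|^2 / (2 L)]. *)
  have := estimate_sequence k (nu k).
  rewrite subrr dotv0r mulr0 addr0.
  have : Ssum R k * Dstar + dotv (nu k - ls) G
      <= \sum_(j < k.+1) theta R j * ell j (nu k).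
    rewrite dotv_sumr /Ssum mulr_suml -big_split /=; apply: ler_sum => j _.
    by rewrite dotvZr -mulrDr ler_pM2l ?theta_gt0.
  have : Ssum R k * D (mu k) <= Ssum R k * Dstar by rewrite ler_pM2l ?Ssum_gt0.
  have -> : nu k - lambda 0%N = L^-1 *: G by rewrite /nu addrC addKr.
  have -> : nu k - ls = (lambda 0%N - ls) + L^-1 *: G.
    by rewrite /nu addrAC.
  move: (lambda 0%N - ls) => r; rewrite !dotv_linear.
  have -> : L / 2 * (L^-1 * (L^-1 * dotv G G)) = dotv G G / (2 * L) by field.
  have -> : L^-1 * dotv G G = 2 * (dotv G G / (2 * L)) by field.
  by rewrite -/E; lra.
have := cauchy_schwarz_dotv (lambda 0%N - ls) G.
move: (enorm_ge0 (lambda 0%N - ls)) (enorm_ge0 G); rewrite -sqr_enorm in key *.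
move: (enorm (lambda 0%N - ls)) (enorm G) key => r x key r0 x0 cs.
have key2 : x ^+ 2 <= 2 * L * r * x + 2 * L * E.
  have {}key : x ^+ 2 / (2 * L) <= r * x + E by lra.
  have := ler_wpM2l (ltW (mulr_gt0 (ltr0n R 2) L_gt0)) key.
  by rewrite mulrCA divff ?mulf_neq0// mulr1; lra.
have LE0 : 0 <= 2 * L * E by rewrite mulr_ge0// mulr_ge0// ltW.
have sE := sqr_sqrtr LE0; have s0 := sqrtr_ge0 (2 * L * E).
move: (Num.sqrt _) sE s0 => s sE s0.
have Lr0 : 0 <= 2 * L * r by rewrite !mulr_ge0// ltW.
move: (2 * L * r) (2 * L * E) Lr0 key2 sE => p q p0 key2 sE.
(* If [x > p + s], then [x (x - p) > s^2 = q], against [key2]. *)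
by rewrite leNgt; apply/negP => lt; nra.
Qed.

End FastGradient.

(** With [p = (k+1)(k+2)], the estimate [1 / S_k <= 4 / p] gives the first term exactly. In the
    second, the tetrahedral bound leaves a factor [1/6] under the root where [1/3] is allowed. *)
Lemma feas_bound_ge (R : realType) (Ld Rd delta : R) k :
  0 < Ld -> 0 <= Rd -> 0 <= delta ->
  (Ssum R k)^-1 * (2 * Ld * Rd
    + Num.sqrt (2 * Ld * (delta * \sum_(j < k.+1) Ssum R j)))
  <= feas_bound Ld Rd delta k.
Proof.
move=> L0 R0 d0; rewrite /feas_bound mulrDr.
have S0 := Ssum_gt0 R k; have := Ssum_ge R k; have := sum_Ssum_le R k.
have k0 : 0 <= k%:R :> R by [].
move: (k%:R) k0 => x x0 Es Sx; set s := Ssum R k in S0 Sx *.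
set p := (x + 1) * (x + 2) in Es Sx *.
have p0 : 0 < p by rewrite mulr_gt0 //; lra.
have Sinv : s^-1 <= 4 / p.
  by rewrite -[4 / p]invrK invf_div lef_pV2 ?posrE// divr_gt0.
have Si0 : 0 <= s^-1 by rewrite invr_ge0 ltW.
have LR0 : 0 <= 2 * Ld * Rd by rewrite !mulr_ge0// ltW.
apply: lerD.
  apply: le_trans (ler_wpM2r LR0 Sinv) _.
  by rewrite le_eqVlt; apply/orP; left; apply/eqP; ring.
have L2 : 0 <= 2 * Ld by rewrite mulr_ge0// ltW.
apply: (@le_trans _ _ (4 / p * Num.sqrt (2 * Ld * (delta * (p * (x + 3) / 6))))).
  apply: ler_pM => //.
  by apply: ler_wsqrtr; rewrite ler_wpM2l// ler_wpM2l.
rewrite -mulrA ler_pM2l//.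
have pi0 : 0 <= p^-1 by rewrite invr_ge0 ltW.
(* The factor [1 / p] goes under the root as [p^-2]. *)
rewrite -[p^-1]ger0_norm// -sqrtr_sqr -sqrtrM ?sqr_ge0//; apply: ler_wsqrtr.
have pn0 : p != 0 by rewrite gt_eqF.
have q0 : 0 <= 2 * Ld * (x + 3) * delta * p^-1.
  by rewrite !mulr_ge0//; [exact: ltW|lra].
apply: (@le_trans _ _ (2 * Ld * (x + 3) * delta * p^-1 / 6)).
  by rewrite le_eqVlt; apply/orP; left; apply/eqP; field.
have -> : 2 * Ld * (x + 3) * delta / (3 * (x + 1) * (x + 2))
    = 2 * Ld * (x + 3) * delta * p^-1 / 3.
  by rewrite -(mulrA 3) -/p; field.
by lra.
Qed.

(** * The augmented Lagrangian as an inexact dual oracle *)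

Section AugmentedLagrangian.
Variables (R : realType) (m n : nat) (f : 'cV[R]_n -> R) (A : 'M[R]_(m, n)).
Variables (b : 'cV[R]_m) (Z : set 'cV[R]_n) (rho : R).
Hypothesis f_convex : convex_function [set: 'cV[R]_n] f.
Hypothesis f_diff : forall z, differentiable f z.
Hypothesis rho_gt0 : 0 < rho.

Let w z := A *m z - b.

Lemma aug_lagrE l z :
  aug_lagr f A b rho l z = f z + dotv l (w z) + rho / 2 * dotv (w z) (w z).
Proof. by rewrite /aug_lagr sqr_enorm. Qed.

Lemma differentiable_residual i z : differentiable (fun y => w y i ord0) z.
Proof.
rewrite (_ : (fun y => w y i ord0) =
   (fun y => dotv (\col_j A i j) y) - cst (b i ord0)); last first.
  apply/funext => y; rewrite !fctE !mxE; congr (_ - _).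
  by apply: eq_bigr => j _; rewrite mxE.
apply: differentiableB; last exact: differentiable_cst.
exact: differentiable_dotvr.
Qed.

Lemma differentiable_lagr l z : differentiable (lagr f A b l) z.
Proof.
rewrite (_ : lagr f A b l = f + \sum_(i < m) (fun y => l i ord0 * w y i ord0)).
  apply: differentiableD => //; apply: differentiable_sum => i.
  apply: differentiableM; first exact: differentiable_cst.
  exact: differentiable_residual.
by apply/funext => y; rewrite !fctE fct_sumE.
Qed.

Lemma differentiable_aug_lagr l z : differentiable (aug_lagr f A b rho l) z.
Proof.
rewrite (_ : aug_lagr f A b rho l = lagr f A b l +
    cst (rho / 2) * \sum_(i < m) (fun y => w y i ord0 * w y i ord0)).
  apply: differentiableD; first exact: differentiable_lagr.
  apply: differentiableM; first exact: differentiable_cst.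
  apply: differentiable_sum => i.
  by apply: differentiableM; exact: differentiable_residual.
by apply/funext => y; rewrite aug_lagrE !fctE fct_sumE.
Qed.

(** Convexity is used for [f] only; the penalty is expanded exactly, which keeps its second-order
    term. *)
Lemma aug_lagr_segment l z y (t : R) : 0 <= t -> t <= 1 ->
  aug_lagr f A b rho l (z + t *: (y - z)) - aug_lagr f A b rho l z
  <= t * (f y - f z + dotv (l + rho *: w z) (w y - w z))
     + t ^+ 2 * (rho / 2 * dotv (w y - w z) (w y - w z)).
Proof.
move=> t0 t1; have := convex_function_segment z y f_convex t0 t1.
have -> : w y - w z = A *m (y - z) by rewrite mulmxBr /w opprB addrA subrK.
rewrite !aug_lagrE.
have -> : w (z + t *: (y - z)) = w z + t *: (A *m (y - z)).
  by rewrite /w mulmxDr -scalemxAr addrAC.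
move: (f (_ + _)) (A *m (y - z)) (w z) => c v u fc.
by rewrite !dotv_linear (dotvC v u); lra.
Qed.

(** Divide [aug_lagr_segment] by [t] and let [t] tend to 0 from the right. *)
Lemma grad_aug_lagr_le l z y :
  dotv (grad (aug_lagr f A b rho l) z) (y - z)
  <= f y - f z + dotv (l + rho *: w z) (w y - w z).
Proof.
have dL := differentiable_aug_lagr l z.
rewrite (dotv_grad _ dL).
set c := f y - _ + _; set K := rho / 2 * dotv (w y - w z) (w y - w z).
have cvL : (h^-1 *: (aug_lagr f A b rho l (h *: (y - z) + z)
             - aug_lagr f A b rho l z)) @[h --> 0^'+] -->
    'D_(y - z) (aug_lagr f A b rho l) z.
  apply: cvg_dnbhs_at_right; exact: (diff_derivable dL).
have cvU : (c + h * K) @[h --> (0 : R)^'+] --> c.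
  rewrite [X in _ --> X](_ : c = c + 0 * K); last by rewrite mul0r addr0.
  apply: cvgD; first exact: cvg_cst.
  apply: cvgMr_tmp; apply: (@cvg_at_right_filter R R idfun 0 0); exact: cvg_id.
apply: (ler_cvg_to cvL cvU); near=> h.
have h0 : 0 < h by near: h; exact: nbhs_right_gt.
have h1 : h <= 1 by near: h; apply: nbhs_right_le; exact: ltr01.
have := aug_lagr_segment l z y (ltW h0) h1; rewrite -/c -/K (addrC z) => H.
rewrite -ler_pdivlMl ?invr_gt0// invrK.
apply: (le_trans H); lra.
Unshelve. all: by end_near.
Qed.

Lemma aug_lagr_oracle l mu z y (delta : R) :
  - delta <= dotv (grad (aug_lagr f A b rho l) z) (y - z) ->
  aug_lagr f A b rho mu z - rho^-1 / 2 * dotv (mu - l) (mu - l) - delta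
  <= aug_lagr f A b rho mu y.
Proof.
move=> /le_trans /(_ (grad_aug_lagr_le _ _ _)).
have rn0 : rho != 0 by rewrite gt_eqF.
(* With [v = w y - w z], the gap contains [<mu - l, v> + rho/2 |v|^2]; this square bounds it below
   by [- |mu - l|^2 / (2 rho)]. *)
have := mulr_ge0 (ltW rho_gt0)
  (dotv_ge0 (w y - w z + rho^-1 *: (mu - l))).
rewrite !aug_lagrE; move: (w y) (w z) => p q.
rewrite (_ : dotv mu p = dotv (mu - l) p + dotv l p); last by rewrite dotvDl dotvNl subrK.
rewrite (_ : dotv mu q = dotv (mu - l) q + dotv l q); last by rewrite dotvDl dotvNl subrK.
move: (mu - l) => d; rewrite !dotv_linear (dotvC p d) (dotvC q d) (dotvC q p).
have E1 x : rho * (rho^-1 * x) = x by field.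
rewrite !mulrDr !mulrN !E1; lra.
Qed.

Hypothesis Z_nonempty : Z !=set0.
Hypothesis Z_compact : compact Z.
Hypothesis Z_convex : convex_set Z.

(* An exact minimiser [z] of the augmented Lagrangian at [l] also minimises the
   ordinary Lagrangian at the shifted multiplier [l + rho (A z - b)]. *)
Lemma min_aug_lagr_le_dual l ls : dual_solution f A b Z ls ->
  min_over Z (aug_lagr f A b rho l) <= dual f A b Z ls.
Proof.
move=> lsP.
have [z Zz zmin] := compact_argmin Z_nonempty Z_compact (differentiable_aug_lagr l).
apply: le_trans (min_over_lb zmin Zz) _.
apply: le_trans (lsP (l + rho *: w z)).
apply: le_min_over => // y Zy.
have first_order : 0 <= f y - f z + dotv (l + rho *: w z) (w y - w z).
  rewrite leNgt; apply/negP => c0.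
  have K0 : 0 <= rho / 2 * dotv (w y - w z) (w y - w z).
    by rewrite mulr_ge0 ?dotv_ge0// ltW// divr_gt0.
  have seg := @aug_lagr_segment l z y.
  move: (f y - _ + _) (rho / 2 * _) c0 K0 seg => c K c0 K0 seg.
  have Kc : 0 < K - c by lra.
  (* As [c < 0 <= K], this [t] lies in [(0, 1]] and [c + t K = - c^2 / (K - c) < 0], so moving
     towards [y] would decrease the minimum. *)
  pose t := - c / (K - c).
  have t0 : 0 < t by rewrite divr_gt0//; lra.
  have t1 : t <= 1 by rewrite ler_pdivrMr//; lra.
  have := zmin _ (convex_set_segment Z_convex Zz Zy (ltW t0) t1).
  have := seg t (ltW t0) t1.
  have : t * (K - c) = - c by rewrite divfK// gt_eqF.
  move: t t0 t1 => t t0 t1 tE H1 H2.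
  have : 0 <= t * (c + t * K) by lra.
  by rewrite pmulr_rge0//; nra.
(* At [z], the shifted Lagrangian exceeds the augmented one by [rho/2 |w z|^2]. *)
rewrite aug_lagrE /lagr -/(w y).
have := mulr_ge0 (ltW rho_gt0) (dotv_ge0 (w z)).
by move: first_order; rewrite !dotv_linear; lra.
Qed.

End AugmentedLagrangian.

Theorem theorem3p7 (R : realType) (m n : nat)
  (f : 'cV[R]_n -> R) (A : 'M[R]_(m, n)) (b : 'cV[R]_m) (Z : set 'cV[R]_n)
  (rho eps_in Lp : R)
  (f_convex : convex_function [set: 'cV[R]_n] f)
  (f_diff : forall z, differentiable f z)
  (A_full : \rank A = m)
  (Z_nonempty : Z !=set0) (Z_compact : compact Z) (Z_convex : convex_set Z)
  (rho_gt0 : 0 < rho) (eps_in_gt0 : 0 < eps_in) (Lp_gt0 : 0 < Lp)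
  (grad_lipschitz : forall (l : 'cV[R]_m) (z y : 'cV[R]_n),
     enorm (grad (aug_lagr f A b rho l) z - grad (aug_lagr f A b rho l) y)
       <= Lp * enorm (z - y))
  (slater_cq : slater A b Z)
  (lambda_star : 'cV[R]_m) (lambda_starP : dual_solution f A b Z lambda_star)
  (Rp := diameter Z) (Ld := 1 / rho)
  (zbar : 'cV[R]_m -> 'cV[R]_n)
  (zbar_in : forall l, Z (zbar l))
  (zbar_approx : forall l,
     min_over Z (fun z => dotv (grad (aug_lagr f A b rho l) (zbar l))
                               (z - zbar l))
       >= - ((1 + Num.sqrt (2 * Lp) * Rp) * eps_in))
  (graddbar := fun l : 'cV[R]_m => A *m zbar l - b)
  (lambda mu : nat -> 'cV[R]_m)
  (muE : forall k, mu k = lambda k + Ld^-1 *: graddbar (lambda k))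
  (lambdaE : forall k, lambda k.+1 =
     (1 - acoef R k.+1) *: mu k +
     acoef R k.+1 *: (lambda 0%N + Ld^-1 *:
       \sum_(i < k.+1) theta R i *: graddbar (lambda i)))
  (Rd := enorm (lambda 0%N - lambda_star))
  (zhat := fun k : nat =>
     (Ssum R k)^-1 *: \sum_(j < k.+1) theta R j *: zbar (lambda j)) :
  forall k : nat,
    enorm (A *m zhat k - b) <=
      feas_bound Ld Rd ((1 + Num.sqrt (2 * Lp) * Rp) * eps_in) k.
Proof.
move=> k; set delta := _ * eps_in.
have gradP l z : Z z ->
    - delta <= dotv (grad (aug_lagr f A b rho l) (zbar l)) (z - zbar l).
  move=> Zz; apply: le_trans (zbar_approx l) _.
  pose c := grad (aug_lagr f A b rho l) (zbar l).
  apply: (@min_over_le _ _ Z (fun y => dotv c (y - zbar l))) => // y.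
  rewrite (_ : (fun _ => _) = (fun y => dotv c y) - cst (dotv c (zbar l))).
    apply: differentiableB; last exact: differentiable_cst.
    exact: differentiable_dotvr.
  by apply/funext => x; rewrite !fctE dotvDr dotvNr.
(* Testing the approximate optimality condition at [zbar] itself forces the sign. *)
have delta0 : 0 <= delta.
  by have := gradP 0 _ (zbar_in 0); rewrite subrr dotv0r oppr_le0.
have Ld0 : 0 < Ld by rewrite divr_gt0.
pose D l := min_over Z (aug_lagr f A b rho l).
pose ell j l := aug_lagr f A b rho l (zbar (lambda j)).
have ell_affine j l l' : ell j l' = ell j l + dotv (graddbar (lambda j)) (l' - l).
  by rewrite /ell /aug_lagr (dotvC (graddbar _)) dotvDl dotvNl; lra.
have D_le_ell j l : D l <= ell j l.
  by apply: min_over_le => // z; exact: differentiable_aug_lagr.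
have ell_le_D j l :
    ell j l - Ld / 2 * dotv (l - lambda j) (l - lambda j) - delta <= D l.
  apply: le_min_over => // z Zz; rewrite /Ld div1r.
  by apply: aug_lagr_oracle => //; exact: gradP.
have D_le l : D l <= dual f A b Z lambda_star by exact: min_aug_lagr_le_dual.
(* Dropping the penalty leaves the Lagrangian, affine in the multiplier and at least the dual value
   at [lambda_star]. *)
have le_ell j l : dual f A b Z lambda_star
    + dotv (l - lambda_star) (graddbar (lambda j)) <= ell j l.
  have : dual f A b Z lambda_star <= lagr f A b lambda_star (zbar (lambda j)).
    by apply: min_over_le => // z; exact: differentiable_lagr.
  rewrite /ell aug_lagrE /lagr dotvDl dotvNl.
  have := mulr_ge0 (ltW rho_gt0) (dotv_ge0 (graddbar (lambda j))).
  by rewrite /graddbar; lra.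
have S0 := Ssum_gt0 R k.
have -> : A *m zhat k - b
    = (Ssum R k)^-1 *: \sum_(j < k.+1) theta R j *: graddbar (lambda j).
  (* The weights sum to [S_k], so averaging commutes with the affine residual. *)
  have -> : \sum_(j < k.+1) theta R j *: graddbar (lambda j)
      = A *m (\sum_(j < k.+1) theta R j *: zbar (lambda j)) - Ssum R k *: b.
    rewrite mulmx_sumr scaler_suml -sumrB; apply: eq_bigr => j _.
    by rewrite scalerBr scalemxAr.
  by rewrite scalerBr scalerA mulVf ?gt_eqF// scale1r /zhat -scalemxAr.
rewrite enormZ ?invr_ge0 ?(ltW S0)//.
apply: le_trans (feas_bound_ge k Ld0 (enorm_ge0 _) delta0).
rewrite ler_pM2l ?invr_gt0//.
exact: (fast_gradient_residual Ld0 ell_affine D_le_ell ell_le_D muE lambdaE k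
  D_le le_ell delta0).
Qed.
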